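(* Let $\triangle$ be a simplicial complex on a finite vertex set $V$, let $M_\triangle$ be its simplicial binoid with generators $x_v$ ($v\in V$), and consider the covering $\{D(x_v)\}_{v\in V}$ of the punctured spectrum $\operatorname{Spec}^\bullet M_\triangle$. For a subset $H\subseteq V$ put $D(H)=D\left(\sum_{v\in H}x_v\right)=\bigcap_{v\in H}D(x_v)$. Then $D(H)\neq\emptyset$ if and only if $H$ is a face of $\triangle$.
   Context: A binoid $(M,+,0,\infty)$ is a commutative monoid $(M,+,0)$ with an absorbing element $\infty$ ($a+\infty=\infty$ for all $a$). An ideal of $M$ is a subset $I\ni\infty$ with $M+I\subseteq I$; it is prime if $I\neq M$ and $a+b\in I$ implies $a\in I$ or $b\in I$. $\operatorname{Spec}M$ is the set of prime ideals of $M$; for $f\in M$, $D(f)=\{\mathfrak p\in\operatorname{Spec}M\mid f\notin\mathfrak p\}$, and these sets form a basis of the Zariski topology. $M^*$ is the group of units, $M_+=M\setminus M^*$ is the unique maximal ideal, and $\operatorname{Spec}^\bullet M=\operatorname{Spec}M\setminus\{M_+\}$. A simplicial complex $\triangle$ on $V$ is a set of subsets of $V$ (faces) closed under taking subsets and containing all singletons $\{v\}$, $v\in V$. Its simplicial binoid $M_\triangle$ is the commutative binoid generated by $x_v$, $v\in V$, with relations $\sum_{v\in H}x_v=\infty$ for every $H\subseteq V$ with $H\notin\triangle$. The empty sum is $0$. *)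

(* Defs.v *)
From HB Require Import structures.
From mathcomp Require Import all_boot all_algebra.
From mathcomp Require Import boolp classical_sets.

Set Implicit Arguments.
Unset Strict Implicit.
Unset Printing Implicit Defensive.

Import GRing.Theory.

Local Open Scope classical_set_scope.
Local Open Scope ring_scope.

HB.mixin Record isBinoid M of GRing.Nmodule M := {
  infty : M;
  addr_infty : forall a : M, a + infty = infty
}.

#[short(type="binoidType")]
HB.structure Definition Binoid := {M of GRing.Nmodule M & isBinoid M}.

Arguments infty {s}.

Section Spectrum.
Variable M : binoidType.

Definition binoid_ideal (I : set M) : Prop :=
  I infty /\ forall a b : M, I b -> I (a + b).

Definition prime_ideal (p : set M) : Prop :=
  [/\ binoid_ideal p, p <> setT & forall a b : M, p (a + b) -> p a \/ p b].

Definition Spec : set (set M) := [set p | prime_ideal p].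

Definition basic_open (f : M) : set (set M) := [set p | Spec p /\ ~ p f].

Definition binoid_units : set M := [set a | exists b : M, a + b = 0].

Definition max_ideal : set M := ~` binoid_units.

Definition punctured_Spec : set (set M) := Spec `\ max_ideal.

End Spectrum.

Arguments Spec M : clear implicits.
Arguments punctured_Spec M : clear implicits.
Arguments max_ideal M : clear implicits.

(* The free commutative monoid on V is {ffun V -> nat} (multiplicities of the
   generators); adjoining an absorbing element None gives the free commutative
   binoid. *)
Definition free_binoid (V : finType) : Type := option {ffun V -> nat}.

Section FreeBinoid.
Variable V : finType.

HB.instance Definition _ := Choice.on (free_binoid V).

Definition free_add (a b : free_binoid V) : free_binoid V :=
  if a is Some f then if b is Some g then Some (f + g) else None else None.

Lemma free_addA : associative free_add.
Proof. by case=> [f|] [g|] [h|] //=; rewrite addrA. Qed.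

Lemma free_addC : commutative free_add.
Proof. by case=> [f|] [g|] //=; rewrite addrC. Qed.

Lemma free_add0 : left_id (Some 0) free_add.
Proof. by case=> [f|] //=; rewrite add0r. Qed.

HB.instance Definition _ :=
  GRing.isNmodule.Build (free_binoid V) free_addA free_addC free_add0.

Lemma free_add_infty (a : free_binoid V) : a + (None : free_binoid V) = None.
Proof. by case: a. Qed.

HB.instance Definition _ := isBinoid.Build (free_binoid V) free_add_infty.

Definition free_gen (v : V) : free_binoid V :=
  Some [ffun w => nat_of_bool (w == v)].

End FreeBinoid.

(* The least congruence containing R; one-sided compatibility suffices since +
   is commutative. *)
Inductive gen_cong (B : binoidType) (R : B -> B -> Prop) : B -> B -> Prop :=
| gen_cong_base a b : R a b -> gen_cong R a b
| gen_cong_refl a : gen_cong R a a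
| gen_cong_sym a b : gen_cong R a b -> gen_cong R b a
| gen_cong_trans b a c : gen_cong R a b -> gen_cong R b c -> gen_cong R a c
| gen_cong_add c a b : gen_cong R a b -> gen_cong R (c + a) (c + b).

Section QuotientBinoid.
Variables (B : binoidType) (R : B -> B -> Prop).
Local Open Scope quotient_scope.

Definition gen_congb : rel B := fun a b => `[< gen_cong R a b >].

Lemma gen_congb_equiv : equiv_class_of gen_congb.
Proof.
split=> [a|a b|b a c].
- exact/asboolP/gen_cong_refl.
- by apply/asboolP/asboolP; apply: gen_cong_sym.
- by move=> /asboolP ab /asboolP bc; apply/asboolP/(gen_cong_trans ab bc).
Qed.

Canonical gen_cong_equiv := EquivRelPack gen_congb_equiv.

Definition quot_binoid : Type := {eq_quot gen_cong_equiv}.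

HB.instance Definition _ := Choice.on quot_binoid.
HB.instance Definition _ := EqQuotient.on quot_binoid.

Definition quot_add (x y : quot_binoid) : quot_binoid :=
  \pi_quot_binoid (repr x + repr y).

Lemma gen_congP (a b : B) :
  reflect (gen_cong R a b) (\pi_quot_binoid a == \pi_quot_binoid b).
Proof. by rewrite eqmodE; apply: asboolP. Qed.

Lemma quot_piD (a b : B) :
  quot_add (\pi_quot_binoid a) (\pi_quot_binoid b) = \pi_quot_binoid (a + b).
Proof.
have rK c : gen_cong R (repr (\pi_quot_binoid c)) c.
  by apply/gen_congP; rewrite reprK.
apply/eqP/gen_congP.
apply: (@gen_cong_trans _ _ (repr (\pi_quot_binoid a) + b)).
  exact: gen_cong_add.
by rewrite ![_ + b]addrC; apply: gen_cong_add.
Qed.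

Lemma quot_addA : associative quot_add.
Proof.
move=> x y z; elim/quotW: x => a; elim/quotW: y => b; elim/quotW: z => c.
by rewrite (quot_piD b c) (quot_piD a b) !quot_piD addrA.
Qed.

Lemma quot_addC : commutative quot_add.
Proof. by move=> x y; elim/quotW: x => a; elim/quotW: y => b; rewrite !quot_piD addrC. Qed.

Lemma quot_add0 : left_id (\pi_quot_binoid 0) quot_add.
Proof. by move=> x; elim/quotW: x => a; rewrite quot_piD add0r. Qed.

HB.instance Definition _ :=
  GRing.isNmodule.Build quot_binoid quot_addA quot_addC quot_add0.

Lemma quot_add_infty (x : quot_binoid) :
  x + \pi_quot_binoid infty = \pi_quot_binoid infty.
Proof. by elim/quotW: x => a; rewrite [LHS]quot_piD addr_infty. Qed.

HB.instance Definition _ := isBinoid.Build quot_binoid quot_add_infty.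

End QuotientBinoid.

Record simplicial_complex (V : finType) := SimplicialComplex {
  faces :> {set {set V}};
  faces_sub : forall F G : {set V}, G \subset F -> F \in faces -> G \in faces;
  faces_vertex : forall v : V, [set v]%SET \in faces
}.

Section SimplicialBinoid.
Variables (V : finType) (K : simplicial_complex V).

Inductive nonface_rel : free_binoid V -> free_binoid V -> Prop :=
| NonfaceRel (H : {set V}) :
    H \notin faces K -> nonface_rel (\sum_(v in H) free_gen v) infty.

Definition simplicial_binoid : Type := quot_binoid nonface_rel.

HB.instance Definition _ := Binoid.on simplicial_binoid.
HB.instance Definition _ := EqQuotient.on simplicial_binoid.

Definition simplicial_gen (v : V) : simplicial_binoid :=
  (\pi_simplicial_binoid (free_gen v))%qT.

(* For H = set0 the sum is 0, which lies in no prime ideal, so face_open set0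
   is the whole spectrum (maximal ideal included), not the punctured one. *)
Definition face_open (H : {set V}) : set (set simplicial_binoid) :=
  basic_open (\sum_(v in H) simplicial_gen v).

End SimplicialBinoid.

Arguments simplicial_gen {V} K v.
Arguments face_open {V} K H.

(* Main.v *)
(** For a face [F], the elements that are [infty] or involve a generator outside
    [F] form a prime ideal: membership is an or-valued character of the free
    binoid, and it respects the relations because no nonface is contained in [F].
    With [F = H] this prime lies in [D(H)]; with [F] empty it shows that no
    generator is a unit. *)
Require Import Defs.
From mathcomp Require Import all_boot all_algebra.
From mathcomp Require Import boolp classical_sets.

Set Implicit Arguments.
Unset Strict Implicit.
Unset Printing Implicit Defensive.

Local Open Scope classical_set_scope.
Local Open Scope ring_scope.

Import GRing.Theory.

Section PrimeIdeals.
Variables (M : binoidType) (p : set M).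
Hypothesis p_prime : prime_ideal p.

(** If [a + b = 0], every [c] equals [c + (a + b)], so an ideal containing [a] is all of [M]. *)
Lemma prime_ideal_not_unit (a : M) : binoid_units a -> ~ p a.
Proof.
case: p_prime => [[_ pD] pT _] [b ab0] pa; apply: pT.
rewrite -subTset => c _; rewrite -(addr0 c) -ab0 (addrC a).
by apply/pD/pD.
Qed.

Lemma prime_ideal_not0 : ~ p 0.
Proof. by apply: prime_ideal_not_unit; exists 0; rewrite addr0. Qed.

Lemma prime_idealD (a b : M) : p (a + b) <-> p a \/ p b.
Proof.
case: p_prime => [[_ pD] _ pV]; split; first exact: pV.
by case=> [pa|pb]; [rewrite addrC|]; apply: pD.
Qed.

(** Reduces membership of a sum over [H] to its generators, which turns $D(H)$ into an intersection;
    the empty sum is covered because [0] lies in no prime. *)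
Lemma prime_ideal_sum (I : finType) (P : pred I) (x : I -> M) :
  p (\sum_(i | P i) x i) <-> exists2 i, P i & p (x i).
Proof.
split=> [|[i Pi pxi]]; last by rewrite (bigD1 i) //=; apply/prime_idealD; left.
apply: (big_ind (fun s => p s -> exists2 i, P i & p (x i))).
- by move/prime_ideal_not0.
- by move=> a b IHa IHb /prime_idealD[/IHa|/IHb].
- by move=> i Pi pxi; exists i.
Qed.

End PrimeIdeals.

Section QuotientPrimes.
Variables (B : binoidType) (R : B -> B -> Prop) (phi : B -> bool).
Hypotheses (phiD : {morph phi : a b / a + b >-> a || b})
  (phiR : forall a b, R a b -> phi a = phi b).

(** Having equal values under [phi] is itself a congruence containing [R], hence contains the least
    one. *)
Lemma gen_cong_invariant (a b : B) : gen_cong R a b -> phi a = phi b.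
Proof.
elim=> {a b} [a b /phiR//|//|a b _ ->//|b a c _ -> _ ->//|c a b _ ab].
by rewrite !phiD ab.
Qed.

Lemma char_repr_pi (a : B) :
  phi (repr (\pi_(quot_binoid R) a)%qT) = phi a.
Proof. by apply/gen_cong_invariant/gen_congP; rewrite reprK. Qed.

(** Additivity into [||] gives absorption and primality at once; the value at [0] gives properness
    and the value at [infty] gives membership of [infty]. *)
Lemma prime_ideal_char :
  phi 0 = false -> phi infty = true ->
  prime_ideal [set x : quot_binoid R | phi (repr x)].
Proof.
move=> phi0 phioo.
have reprD (x y : quot_binoid R) : phi (repr (x + y)) = phi (repr x) || phi (repr y).
  by rewrite -phiD; apply: char_repr_pi.
split.
- split=> [|a b /= pb]; first by rewrite /= char_repr_pi.
  by rewrite reprD pb orbT.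
- move=> pT; have : [set: quot_binoid R] (\pi_(quot_binoid R) 0)%qT by [].
  by rewrite -pT /= char_repr_pi phi0.
- by move=> a b /=; rewrite reprD => /orP.
Qed.

End QuotientPrimes.

Section OffFace.
Variables (V : finType) (F : {set V}).

Definition involves_outside (a : free_binoid V) : bool :=
  if a is Some f then [exists v, (v \notin F) && (0 < f v)%N] else true.

Lemma involves_outsideD : {morph involves_outside : a b / a + b >-> a || b}.
Proof.
case=> [f|//] [g|]; last by rewrite orbT.
apply/existsP/orP => [[v]|[]/existsP[v /andP[vF v_gt0]]].
- rewrite ffunE addn_gt0 => /andP[vF /orP[]v_gt0]; [left|right];
    by apply/existsP; exists v; rewrite vF.
- by exists v; rewrite vF ffunE addn_gt0 v_gt0.
- by exists v; rewrite vF ffunE addn_gt0 v_gt0 orbT.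
Qed.

Lemma involves_outside0 : involves_outside 0 = false.
Proof. by apply/existsP => -[v]; rewrite ffunE andbF. Qed.

Lemma involves_outside_gen (v : V) : involves_outside (free_gen v) = (v \notin F).
Proof.
apply/existsP/idP => [[w]|vF]; last by exists v; rewrite vF ffunE eqxx.
by rewrite ffunE; case: eqVneq => [->|_]; rewrite ?andbT ?andbF.
Qed.

Lemma involves_outside_sum (H : {set V}) :
  involves_outside (\sum_(v in H) free_gen v) = ~~ (H \subset F).
Proof.
rewrite (big_morph _ involves_outsideD involves_outside0).
under eq_bigr do rewrite involves_outside_gen.
by rewrite big_orE; apply/exists_inP/subsetPn.
Qed.

End OffFace.

Lemma free_gen_dvd (V : finType) (f : {ffun V -> nat}) (v : V) :
  (0 < f v)%N -> exists b : free_binoid V, Some f = free_gen v + b.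
Proof.
(* The subtraction is truncated, but at [v] nothing is lost since [f v] is positive. *)
move=> fv_gt0; exists (Some [ffun w => f w - (w == v)]%N); congr Some.
apply/ffunP=> w; rewrite !ffunE; case: eqVneq => [->|_] /=.
- by rewrite -[LHS](subnKC fv_gt0).
- by rewrite subn0 add0r.
Qed.

Section SimplicialSpectrum.
Variables (V : finType) (K : simplicial_complex V).
Local Notation M := (simplicial_binoid K).

Definition face_prime (F : {set V}) : set M :=
  [set x | involves_outside F (repr x)].

(** Both values are true: [infty] counts as involving an outside generator, and a nonface inside [F]
    would be a face by closure under subsets. *)
Lemma involves_outside_nonface (F : {set V}) (a b : free_binoid V) :
  F \in faces K -> nonface_rel K a b ->
  involves_outside F a = involves_outside F b.
Proof.
move=> FK [H HK]; rewrite involves_outside_sum.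
by apply/negP => /faces_sub/(_ FK); apply/negP.
Qed.

Lemma face_prime_prime (F : {set V}) : F \in faces K -> prime_ideal (face_prime F).
Proof.
move=> FK; apply: prime_ideal_char.
- exact: involves_outsideD.
- by move=> a b; apply: involves_outside_nonface.
- exact: involves_outside0.
- by [].
Qed.

Lemma face_prime_gen (F : {set V}) (v : V) :
  F \in faces K -> face_prime F (simplicial_gen K v) <-> v \notin F.
Proof.
move=> FK; rewrite /face_prime /= char_repr_pi ?involves_outside_gen //.
- exact: involves_outsideD.
- by move=> a b; apply: involves_outside_nonface.
Qed.

Lemma simplicial_gen_not_unit (v : V) : ~ binoid_units (simplicial_gen K v).
Proof.
(* The vertex [v] is what guarantees that the empty set is a face. *)
have K0 : finset.set0 \in faces K.
  exact: faces_sub (finset.sub0set _) (faces_vertex K v).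
move=> /(prime_ideal_not_unit (face_prime_prime K0)); apply.
by apply/face_prime_gen; rewrite ?inE.
Qed.

(** Every nonunit is the class of [infty] or of a monomial divisible by some generator, so it lies
    in [p]; thus only the maximal ideal escapes all the $D(x_v)$. *)
Lemma prime_with_gens_max (p : set M) :
  prime_ideal p -> (forall v, p (simplicial_gen K v)) -> p = max_ideal M.
Proof.
move=> p_prime pgen; apply/seteqP; split=> x.
  by move=> px /(prime_ideal_not_unit p_prime).
elim/quotW: x => -[f|_]; last by case: p_prime => -[].
have [/existsP[v fv_gt0] _|f0] := boolP [exists v, (0 < f v)%N].
  have [b ->] := free_gen_dvd fv_gt0.
  rewrite -[X in p X](@quot_piD _ (nonface_rel K)).
  by apply/(prime_idealD p_prime); left; apply: pgen.
(* No generator occurs, so the class is the unit [0], contrary to its lying in the maximal ideal. *)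
have -> : f = 0.
  apply/ffunP=> v; rewrite ffunE; apply/eqP; rewrite -leqn0 leqNgt.
  by apply: contra f0 => fv_gt0; apply/existsP; exists v.
by case; exists 0; rewrite addr0.
Qed.

Lemma sum_simplicial_gen (H : {set V}) :
  \sum_(v in H) simplicial_gen K v = (\pi_M (\sum_(v in H) free_gen v))%qT.
Proof.
apply: esym; apply: (big_morph (fun a => (\pi_M a)%qT) _ (erefl _)) => a b.
exact/esym/quot_piD.
Qed.

Lemma sum_nonface (H : {set V}) :
  H \notin faces K -> \sum_(v in H) simplicial_gen K v = infty.
Proof.
move=> HK; rewrite sum_simplicial_gen.
exact/eqP/(@gen_congP _ (nonface_rel K))/gen_cong_base/NonfaceRel.
Qed.

End SimplicialSpectrum.

Theorem lemma2p6 (V : finType) (K : simplicial_complex V) :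
  punctured_Spec (simplicial_binoid K)
    = \bigcup_(v in [set: V]) basic_open (simplicial_gen K v)
  /\ forall H : {set V},
       face_open K H
         = Spec (simplicial_binoid K)
             `&` \bigcap_(v in [set` H]) basic_open (simplicial_gen K v)
       /\ (face_open K H <> set0 <-> H \in faces K).
Proof.
split.
  apply/seteqP; split=> p.
    move=> [p_prime p_max]; apply: contrapT => pgen; apply: p_max.
    apply: prime_with_gens_max => // v; apply: contrapT => pv.
    by apply: pgen; exists v.
  (* Conversely, the maximal ideal contains every generator, so a prime omitting one differs from
     it. *)
  move=> [v _ [p_prime pv]]; split=> // p_max; apply: pv.
  by rewrite p_max; apply: simplicial_gen_not_unit.
move=> H; split.
  apply/seteqP; split=> p [p_prime pH]; split=> //.
    move=> v /= vH; split=> // pv; apply: pH.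
    by apply/(prime_ideal_sum p_prime); exists v.
  by move=> /(prime_ideal_sum p_prime)[v /pH[_ npv] /npv].
split=> [/eqP/set0P[p [p_prime]]|HK].
  (* For a nonface the sum is [infty], which every prime contains. *)
  apply: contra_notT => HK; rewrite sum_nonface //.
  by case: p_prime => -[].
apply/eqP/set0P; exists (@face_prime V K H).
have Hprime := face_prime_prime HK; split=> //.
by move=> /(prime_ideal_sum Hprime)[v vH /(face_prime_gen _ HK)/negP].
Qed.
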